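(* Let $q\in(0,1)$, let $j_1,j_2\in\{0,\tfrac12,1,\tfrac32,\dots\}$, $j\in\{|j_1-j_2|,|j_1-j_2|+1,\dots,j_1+j_2\}$, $m_i\in\{-j_i,-j_i+1,\dots,j_i\}$ for $i=1,2$, and assume $m:=m_1+m_2$ satisfies $-j\le m\le j$. Then the Clebsch-Gordan coefficients of $su_q(2)$ satisfy $$\langle j_1m_1,j_2m_2|jm\rangle_q=(-1)^{j_1+j_2-j}\,\langle j_2m_2,j_1m_1|jm\rangle_{1/q}.$$
   Context: Notation. For real $q>0$, $q\ne1$: $[x]_q=\frac{q^x-q^{-x}}{q-q^{-1}}$ for $x\in\mathbb R$; $[0]_q!=1$ and $[n]_q!=[1]_q[2]_q\cdots[n]_q$ for $n\in\mathbb N$. Representations. For $j\in\{0,\frac12,1,\dots\}$, $D^j$ is the complex inner product space with orthonormal basis $|jm\rangle$, $m=-j,-j+1,\dots,j$, and operators $$J_0|jm\rangle=m|jm\rangle,\quad J_-|jm\rangle=\sqrt{[j+m]_q[j-m+1]_q}\,|j\,m-1\rangle,\quad J_+|jm\rangle=\sqrt{[j-m]_q[j+m+1]_q}\,|j\,m+1\rangle,$$ and $q^{aJ_0}|jm\rangle=q^{am}|jm\rangle$. On $D^{j_1}\otimes D^{j_2}$ (orthonormal basis $|j_1m_1\rangle|j_2m_2\rangle$) put $J_0(12)=J_0\otimes1+1\otimes J_0$ and $J_\pm(12)=J_\pm\otimes q^{J_0}+q^{-J_0}\otimes J_\pm$. Clebsch-Gordan coefficients. For $j\in\{|j_1-j_2|,\dots,j_1+j_2\}$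 and $m\in\{-j,\dots,j\}$ let $$P^j_{mj}=\sqrt{\frac{[j+m]_q!}{[2j]_q!\,[j-m]_q!}}\sum_{r\ge0}\frac{(-1)^r[2j+1]_q!}{[r]_q!\,[2j+r+1]_q!}\,J_-(12)^{\,r+j-m}J_+(12)^{\,r}$$ (a finite sum, since $J_+(12)$ is nilpotent), and let $|j_1,j_2:jm\rangle$ be the unit vector $P^j_{mj}|j_1j_1\rangle|j_2\,j-j_1\rangle/\|P^j_{mj}|j_1j_1\rangle|j_2\,j-j_1\rangle\|$. For $m=m_1+m_2$, $\langle j_1m_1,j_2m_2|jm\rangle_q$ denotes the coefficient of $|j_1m_1\rangle|j_2m_2\rangle$ in $|j_1,j_2:jm\rangle$. The subscript indicates the base; $\langle\cdots\rangle_{1/q}$ is the same quantity with $q$ replaced by $1/q$ everywhere in the construction (in particular in the operators $J_\pm(12)$). *)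

(* Defs.v *)
From mathcomp Require Import all_boot all_order all_algebra.
From mathcomp Require Import reals exp.
From mathcomp.real_closed Require Import complex mxtens.

Set Implicit Arguments.
Unset Strict Implicit.
Unset Printing Implicit Defensive.

Import Order.TTheory GRing.Theory Num.Theory.
Local Open Scope ring_scope.
Local Open Scope complex_scope.

(* A spin j in {0, 1/2, 1, ...} is encoded by the natural number n = 2j, and a
   weight m in {-j, -j+1, ..., j} by the ordinal i : 'I_n.+1 with m = i - j.
   Thus j + m and j - m are the natural numbers i and n - i. *)
Definition spin (R : realType) (n : nat) : R := n%:R / 2.

Definition weight (R : realType) (n : nat) (i : 'I_n.+1) : R :=
  i%:R - spin R n.

Definition qnum (R : realType) (q x : R) : R :=
  (q `^ x - q `^ (- x)) / (q - q^-1).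

Definition qfact (R : realType) (q : R) (n : nat) : R :=
  \prod_(1 <= k < n.+1) qnum q k%:R.

(* D^j is 'cV[R[i]]_n.+1 with operators acting on the left. The vector |j m> is
   indexed by the real number m; it is 0 when m is not a weight of D^j. *)
Definition ket (R : realType) (n : nat) (m : R) : 'cV[R[i]]_n.+1 :=
  \col_i (weight R i == m)%:R.

Definition Jminus (R : realType) (q : R) (n : nat) : 'M[R[i]]_n.+1 :=
  \matrix_(i, k)
    let j := spin R n in
    let m := weight R k in
    (Num.sqrt (qnum q (j + m) * qnum q (j - m + 1)))%:C * ket n (m - 1) i 0.

Definition Jplus (R : realType) (q : R) (n : nat) : 'M[R[i]]_n.+1 :=
  \matrix_(i, k)
    let j := spin R n in
    let m := weight R k in
    (Num.sqrt (qnum q (j - m) * qnum q (j + m + 1)))%:C * ket n (m + 1) i 0.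

(* The operator q^(a J_0). *)
Definition qJ0 (R : realType) (q a : R) (n : nat) : 'M[R[i]]_n.+1 :=
  diag_mx (\row_k (q `^ (a * weight R k))%:C).

(* On D^j1 (x) D^j2, for the Kronecker product *t; the basis vector
   |j1 m1>|j2 m2> has index mxtens_index (m1, m2). *)
Definition Jminus12 (R : realType) (q : R) (n1 n2 : nat) :
    'M[R[i]]_(n1.+1 * n2.+1) :=
  Jminus q n1 *t qJ0 q 1 n2 + qJ0 q (- 1) n1 *t Jminus q n2.

Definition Jplus12 (R : realType) (q : R) (n1 n2 : nat) :
    'M[R[i]]_(n1.+1 * n2.+1) :=
  Jplus q n1 *t qJ0 q 1 n2 + qJ0 q (- 1) n1 *t Jplus q n2.

(* P^j_{mj}, with [j+m]! = qfact q m, [j-m]! = qfact q (n - m) and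
   [2j]! = qfact q n. The terms with r > 2(j1+j2) = n1 + n2 are omitted:
   J_+(12) raises the total weight, which lies in [-(j1+j2), j1+j2], by 1, so
   its (n1+n2+1)-st power is 0. *)
Definition projP (R : realType) (q : R) (n1 n2 n : nat) (m : 'I_n.+1) :
    'M[R[i]]_(n1.+1 * n2.+1) :=
  (Num.sqrt (qfact q m / (qfact q n * qfact q (n - m))))%:C *:
  \sum_(r < (n1 + n2).+1)
    ((-1) ^+ r * qfact q n.+1 / (qfact q r * qfact q (n + r + 1)))%:C *:
    (Jminus12 q n1 n2 ^+ (r + (n - m)) *m Jplus12 q n1 n2 ^+ r).

Definition vnorm (R : realType) (N : nat) (v : 'cV[R[i]]_N) : R[i] :=
  sqrtC (\sum_k `|v k 0| ^+ 2).

(* The unit vector |j1, j2 : j m>. *)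
Definition coupled (R : realType) (q : R) (n1 n2 n : nat) (m : 'I_n.+1) :
    'cV[R[i]]_(n1.+1 * n2.+1) :=
  let v := projP q n1 n2 m *m
    (ket n1 (spin R n1) *t ket n2 (spin R n - spin R n1)) in
  (vnorm v)^-1 *: v.

(* The coefficient < j1 m1, j2 m2 | j m >_q. *)
Definition clebsch_gordan (R : realType) (q : R) (n1 n2 n : nat)
    (m1 : 'I_n1.+1) (m2 : 'I_n2.+1) (m : 'I_n.+1) : R[i] :=
  coupled q n1 n2 m (mxtens_index (m1, m2)) 0.

(* Main.v *)
Require Import Defs.
From mathcomp Require Import all_boot all_order all_algebra.
From mathcomp Require Import reals exp.
From mathcomp.real_closed Require Import complex mxtens.
From mathcomp Require Import ring lra zify.

Set Implicit Arguments.
Unset Strict Implicit.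
Unset Printing Implicit Defensive.

Import Order.TTheory GRing.Theory Num.Theory.
Local Open Scope ring_scope.
Local Open Scope complex_scope.

(** Truncating at [r = n1 + n2], let [S] be the sum of the [F^r E^r] with the
    coefficients of the extremal projector, where [E = J_+(12)] and
    [F = J_-(12)], so that [P^j_{mj}] is a positive multiple of [F^(j-m) S].
    The commutation relation [[E, F] = [2 J_0]] makes [E S x] telescope to [0]
    for [x] of weight [j]. A vector of weight [j] killed by [E] is determined by
    one of its coordinates, and its consecutive coordinates have alternating
    signs. As [S] is symmetric ([E^T = F]), the images under [S] of the two
    extreme basis vectors x = |j1 j1>|j2 j-j1> and y = |j1 j-j2>|j2 j2> satisfy
    [S y = (-1)^(j1+j2-j) r S x] with [r > 0], and this persists after applying
    [F^(j-m)] and normalizing. Exchanging the two tensor factors turns the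
    construction for [q] and [y] into the one for [1/q] on [D^j2 (x) D^j1]. *)

(** * Arithmetic of q-numbers *)

Section QNumbers.
Variable R : realType.
Implicit Types q x a b : R.

Lemma powVR q x : 0 <= q -> q^-1 `^ x = q `^ (- x).
Proof. by move=> q0; rewrite -(powR_inv1 q0) -powRrM mulN1r. Qed.

(** Numerator and denominator both change sign. Hence only the [qJ0] factors will distinguish base
    [q] from base [1/q]. *)
Lemma qnumV q x : 0 < q -> qnum q^-1 x = qnum q x.
Proof.
move=> q0; rewrite /qnum !powVR ?ltW // opprK invrK.
by rewrite -opprB -[q^-1 - q]opprB invrN mulrNN.
Qed.

Lemma qfactV q k : 0 < q -> qfact q^-1 k = qfact q k.
Proof. by move=> q0; apply: eq_bigr => i _; apply: qnumV. Qed.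

Lemma qnum0 q : qnum q 0 = 0.
Proof. by rewrite /qnum oppr0 subrr mul0r. Qed.

Lemma qnum_gt0 q x : 0 < q -> q < 1 -> 0 < x -> 0 < qnum q x.
Proof.
move=> q0 q1 x0.
(* Numerator and denominator both have the form [p - p^-1] with [0 < p < 1], so both are
   negative. *)
have lt_qV (p : R) : 0 < p -> p < 1 -> p - p^-1 < 0.
  by move=> p0 p1; rewrite subr_lt0 (lt_trans p1) ?invf_gt1.
rewrite /qnum nmulr_rgt0 ?invr_lt0 ?lt_qV // powRN lt_qV ?powR_gt0 //.
have := gt0_ltr_powR x0 (ltW q0 : q \in Num.nneg) (ler01 : 1 \in Num.nneg) q1.
by rewrite powR1.
Qed.

Lemma qnum_ge0 q x : 0 < q -> q < 1 -> 0 <= x -> 0 <= qnum q x.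
Proof.
move=> q0 q1; rewrite le_eqVlt => /predU1P[<-|x0]; first by rewrite qnum0.
exact/ltW/qnum_gt0.
Qed.

Lemma qfact_gt0 q k : 0 < q -> q < 1 -> 0 < qfact q k.
Proof.
move=> q0 q1; rewrite /qfact big_seq; apply: prodr_gt0 => i.
by rewrite mem_index_iota => /andP[i0 _]; rewrite qnum_gt0 ?ltr0n.
Qed.

Lemma qfactS q k : qfact q k.+1 = qfact q k * qnum q k.+1%:R.
Proof. by rewrite /qfact big_nat_recr. Qed.

Lemma qdenom_neq0 q : 0 < q -> q < 1 -> q - q^-1 != 0.
Proof.
move=> q0 q1; have := q1; rewrite -(invf_gt1 q0) subr_eq0 => lt1V.
by rewrite lt_eqF // (lt_trans q1 lt1V).
Qed.

Lemma powRD_gt0 q x y : 0 < q -> q `^ (x + y) = q `^ x * q `^ y.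
Proof. by move=> q0; rewrite powRD // (gt_eqF q0) implybT. Qed.

(** The identity behind the commutators: it gives [[2 J_0]] on a single factor and the inductive
    step when [E] is moved past a power of [F]. *)
Lemma qnum_mulB q a b : 0 < q -> q < 1 ->
  qnum q (a + 1) * qnum q b - qnum q a * qnum q (b + 1) = qnum q (b - a).
Proof.
move=> q0 q1; have d0 := qdenom_neq0 q0 q1; have qn0 := lt0r_neq0 q0.
rewrite /qnum !opprD opprK !powRD_gt0 // !powRN powRr1 ?ltW //.
have A0 := lt0r_neq0 (powR_gt0 a q0); have B0 := lt0r_neq0 (powR_gt0 b q0).
move: d0; set A := q `^ a in A0 *; set B := q `^ b in B0 * => d0.
field; rewrite qn0 A0 B0 /= andbT.
(* [field] asks for [q^2 - 1] to be nonzero; this is [q] times the denominator [q - q^-1]. *)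
apply: contraNneq d0 => e.
by rewrite -(mulfK qn0 (q - q^-1)) mulrBl mulVf // -expr2 e mul0r.
Qed.

(** Adds up the diagonal terms of the two tensor factors, so that the commutator on the product is
    again [[2 mu]] at weight [mu]. *)
Lemma qnum_coproduct q a b : 0 < q -> q < 1 ->
  qnum q a * q `^ b + q `^ (- a) * qnum q b = qnum q (a + b).
Proof.
move=> q0 q1; have d0 := qdenom_neq0 q0 q1.
rewrite /qnum opprD !powRD_gt0 //.
by ring.
Qed.

End QNumbers.

(** * The extremal projector for abstract raising and lowering operators *)

Section ExtremalProjector.
Variables (R : realType) (q : R) (N : nat) (E F : 'M[R[i]]_N).
(** Weight spaces are kept abstract; on them [[2 J_0]] acts as a scalar, so no operator [J_0] has to
    be introduced. *)
Variable has_weight : R -> 'cV[R[i]]_N -> Prop.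
Hypotheses (q_gt0 : 0 < q) (q_lt1 : q < 1).
Hypothesis raise : forall mu v, has_weight mu v -> has_weight (mu + 1) (E *m v).
Hypothesis lower : forall mu v, has_weight mu v -> has_weight (mu - 1) (F *m v).
Hypothesis commEF : forall mu v, has_weight mu v ->
  E *m (F *m v) = F *m (E *m v) + (qnum q (2 * mu))%:C *: v.

Definition extremal_coef (n r : nat) : R :=
  (-1) ^+ r * qfact q n.+1 / (qfact q r * qfact q (n + r + 1)).

Definition extremal (n b : nat) : 'M[R[i]]_N :=
  \sum_(r < b.+1) (extremal_coef n r)%:C *: (F ^+ r *m E ^+ r).

Lemma raiseX mu v r : has_weight mu v -> has_weight (mu + r%:R) (E ^+ r *m v).
Proof.
elim: r => [|r IHr] wv; first by rewrite addr0 expr0 mul1mx.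
by rewrite -natr1 addrA exprS -mulmxE -mulmxA; apply/raise/IHr.
Qed.

Lemma lowerX mu v r : has_weight mu v -> has_weight (mu - r%:R) (F ^+ r *m v).
Proof.
elim: r => [|r IHr] wv; first by rewrite subr0 expr0 mul1mx.
by rewrite -natr1 opprD addrA exprS -mulmxE -mulmxA; apply/lower/IHr.
Qed.

(** Moving [E] past one [F] at a time produces the scalars [[2 (mu - s)]] for [s <= r]; [qnum_mulB]
    sums them to the product. *)
Lemma commEFX mu v r : has_weight mu v ->
  E *m (F ^+ r.+1 *m v) = F ^+ r.+1 *m (E *m v)
    + (qnum q r.+1%:R * qnum q (2 * mu - r%:R))%:C *: (F ^+ r *m v).
Proof.
move=> wv; have q0 := qnum0 q.
elim: r => [|r IHr].
  rewrite !expr1 expr0 mul1mx subr0 (commEF wv); congr (_ + _%:C *: _).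
  (* At [a = 0] the identity supplies [[1] [b] = [b]]. *)
  have := qnum_mulB 0 (2 * mu) q_gt0 q_lt1.
  by rewrite add0r q0 mul0r !subr0.
rewrite exprS -mulmxE -!mulmxA (commEF (lowerX _ wv)) IHr mulmxDr.
rewrite -scalemxAr !mulmxA mulmxE -addrA; congr (_ + _).
rewrite -exprS -scalerDl -rmorphD /=; congr (_%:C *: _).
have e1 : 2 * mu - r.+1%:R + 1 = 2 * mu - r%:R by rewrite -natr1; ring.
have e2 : 2 * mu - r.+1%:R - r.+1%:R = 2 * (mu - r.+1%:R) by ring.
have := qnum_mulB r.+1%:R (2 * mu - r.+1%:R) q_gt0 q_lt1.
by rewrite natr1 e1 e2 => <-; rewrite addrC subrK.
Qed.

(** The recursion that the coefficients are designed for: [[r+1] [n+r+2]] is the scalar of [commEFX]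
    at [mu = n/2 + r + 1], the weight of [E^(r+1) v]. *)
Lemma extremal_coefS n r :
  extremal_coef n r.+1 * (qnum q r.+1%:R * qnum q (n + r + 2)%:R)
    = - extremal_coef n r.
Proof.
have f0 k : qfact q k != 0 by rewrite lt0r_neq0 ?qfact_gt0.
have n0 k : qnum q k.+1%:R != 0 by rewrite lt0r_neq0 ?qnum_gt0 ?ltr0n.
rewrite /extremal_coef addn1 addn2 addnS addn1 exprS !qfactS.
move: (f0 r) (f0 (n + r)%N) (n0 r) (n0 (n + r)%N) (n0 (n + r).+1).
move: (qfact q r) (qfact q (n + r)) (qnum q r.+1%:R) (qnum q (n + r).+1%:R).
by move: (qnum q (n + r).+2%:R) => a b c d e b0 c0 d0 e0 a0;
  field; rewrite a0 b0 c0 d0 e0.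
Qed.

Lemma extremal_highest n b v : has_weight (n%:R / 2) v ->
  E ^+ b.+1 *m v = 0 -> E *m (extremal n b *m v) = 0.
Proof.
move=> wv Ev0.
(* [E] maps the [r]-th term of the sum to [T r.+1 - T r]. The value [T 0 = 0] covers [r = 0], where
   there is no [F] to cross, and [T b.+1] vanishes because [E^(b+1) v = 0]. *)
pose T k : 'cV[R[i]]_N := if k is r.+1
  then (extremal_coef n r)%:C *: (F ^+ r *m (E ^+ r.+1 *m v)) else 0.
rewrite mulmx_suml mulmx_sumr.
transitivity (\sum_(0 <= r < b.+1) (T r.+1 - T r)); last first.
  by rewrite telescope_sumr //= Ev0 mulmx0 scaler0 subr0.
rewrite big_mkord; apply: eq_bigr => -[[|r] /= _] _.
  by rewrite subr0 -!scalemxAl -scalemxAr !expr0 expr1 !mul1mx.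
rewrite -scalemxAl -scalemxAr -mulmxA (commEFX _ (raiseX _ wv)) scalerDr.
rewrite (_ : E *m (E ^+ r.+1 *m v) = E ^+ r.+2 *m v); last first.
  by rewrite mulmxA mulmxE -exprS.
congr (_ + _).
rewrite scalerA -scaleNr -rmorphM -rmorphN /=; congr (_%:C *: _).
rewrite -extremal_coefS; congr (_ * (_ * qnum q _)).
by rewrite -natr1 !natrD; field.
Qed.

Lemma trmx_extremal n b : E^T = F -> (extremal n b)^T = extremal n b.
Proof.
move=> trE; rewrite linear_sum; apply: eq_bigr => r _.
have trX (A : 'M[R[i]]_N) k : (A ^+ k)^T = A^T ^+ k.
  by elim: k => [|k IHk]; rewrite ?trmx1 // exprSr exprS -!mulmxE trmx_mul IHk.
by rewrite linearZ /= trmx_mul !trX -trE trmxK.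
Qed.

End ExtremalProjector.

(** * Matrix elements and commutation relations on a single [D^j] *)

Section TensorProduct.
Variable R : realType.
Implicit Types (q : R) (n : nat).

Lemma weight_inj n : injective (@weight R n).
Proof.
by move=> i k /addIr /eqP; rewrite eqr_nat => /eqP; apply: val_inj.
Qed.

Lemma JplusE q n (i k : 'I_n.+1) : Jplus q n i k =
  (Num.sqrt (qnum q (n - k)%:R * qnum q k.+1%:R))%:C * (i == k.+1 :> nat)%:R.
Proof.
have kn : (k <= n)%N by rewrite -ltnS.
rewrite !mxE /weight /spin [k%:R - _ + 1]addrAC mxE (inj_eq (addIr _)) natr1 eqr_nat.
rewrite natrB // -natr1; congr ((Num.sqrt _)%:C * _).
by congr (qnum q _ * qnum q _); field.
Qed.

(** The transitions [m -> m+1] and [m+1 -> m] carry the same square root. Facts on [Jminus] thus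
    follow from those on [Jplus] by transposition. *)
Lemma trmx_Jplus q n : (Jplus q n)^T = Jminus q n.
Proof.
apply/matrixP => i k; rewrite [_^T _ _]mxE JplusE !mxE /weight /spin.
rewrite [k%:R - _ - 1]addrAC mxE (inj_eq (addIr _)) [_%:R == _]eq_sym.
rewrite subr_eq natr1 eqr_nat.
have [ki|_] := eqVneq; last by rewrite !mulr0.
have kn : (k <= n)%N by rewrite -ltnS.
congr ((Num.sqrt _)%:C * _); rewrite mulrC.
rewrite natrB; last by rewrite -ltnS.
by rewrite ki -natr1; congr (qnum q _ * qnum q _); field.
Qed.

Lemma qJ0E q a n (i k : 'I_n.+1) :
  qJ0 q a n i k = (q `^ (a * weight R i))%:C * (i == k)%:R.
Proof. by rewrite !mxE mulr_natr; case: eqVneq => // ->. Qed.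

Lemma JplusV q n : 0 < q -> Jplus q^-1 n = Jplus q n.
Proof. by move=> q0; apply/matrixP => i k; rewrite !JplusE !qnumV. Qed.

Lemma JminusV q n : 0 < q -> Jminus q^-1 n = Jminus q n.
Proof. by move=> q0; rewrite -!trmx_Jplus JplusV. Qed.

Lemma qJ0V q a n : 0 < q -> qJ0 q^-1 a n = qJ0 q (- a) n.
Proof.
by move=> q0; apply/matrixP => i k; rewrite !qJ0E powVR ?ltW // mulNr.
Qed.

(** Both products are diagonal, with entries [[j+m] [j-m+1]] and [[j-m] [j+m+1]]; their difference
    is an instance of [qnum_mulB]. *)
Lemma Jplus_Jminus q n : 0 < q -> q < 1 ->
  Jplus q n *m Jminus q n - Jminus q n *m Jplus q n =
  diag_mx (\row_k (qnum q (2 * weight R k))%:C).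
Proof.
move=> q0 q1; rewrite -trmx_Jplus; apply/matrixP => i k; rewrite !mxE.
have sqr (a b : nat) : (Num.sqrt (qnum q a%:R * qnum q b%:R))%:C
    * (Num.sqrt (qnum q a%:R * qnum q b%:R))%:C = (qnum q a%:R * qnum q b%:R)%:C.
  by rewrite -rmorphM /= -expr2 sqr_sqrtr // mulr_ge0 ?qnum_ge0.
have -> : \sum_j Jplus q n i j * (Jplus q n)^T j k
    = (qnum q i%:R * qnum q (n - i).+1%:R)%:C *+ (i == k).
  (* At the lowest weight no term survives and the formula agrees because [[0] = 0]; otherwise only
     [j = i - 1] survives. *)
  case: (posnP i) => [i0|i_gt0].
    rewrite i0 qnum0 mul0r mul0rn big1 // => j _.
    by rewrite JplusE i0 /= mulr0 mul0r.
  have lin : (i.-1 < n.+1)%N by rewrite (leq_ltn_trans (leq_pred _)).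
  have ii : i.-1.+1 = i by rewrite prednK.
  rewrite (bigD1 (Ordinal lin)) //= big1 ?addr0; last first.
    move=> j; rewrite JplusE => jne.
    suff /negPf -> : (i : nat) != j.+1 by rewrite mulr0 mul0r.
    by apply: contra jne => /eqP ij; apply/eqP/val_inj; rewrite /= ij.
  rewrite [_^T _ _]mxE !JplusE /= ii eqxx mulr1 mulrA sqr mulr_natr.
  have -> : (n - i.-1 = (n - i).+1)%N by have := ltn_ord i; lia.
  by rewrite eq_sym [qnum q (n - i).+1%:R * _]mulrC.
have -> : \sum_j (Jplus q n)^T i j * Jplus q n j k
    = (qnum q (n - i)%:R * qnum q i.+1%:R)%:C *+ (i == k).
  (* Likewise [[n - i] = 0] covers the top weight; otherwise only [j = i + 1] survives. *)
  case: (ltnP i n) => [i_ltn|i_gen]; last first.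
    have -> : (n - i = 0)%N by apply/eqP; rewrite subn_eq0.
    rewrite qnum0 mul0r mul0rn big1 // => j _.
    have := ltn_ord j; rewrite [_^T _ _]mxE JplusE ltnS => jn.
    by rewrite (_ : (j == i.+1 :> nat) = false) ?mulr0 ?mul0r //; apply/eqP; lia.
  have lin : (i.+1 < n.+1)%N by [].
  rewrite (bigD1 (Ordinal lin)) //= big1 ?addr0; last first.
    move=> j; rewrite [_^T _ _]mxE JplusE => jne.
    suff /negPf -> : (j : nat) != i.+1 by rewrite mulr0 mul0r.
    by apply: contra jne => /eqP ji; apply/eqP/val_inj.
  rewrite [_^T _ _]mxE !JplusE /= eqxx mulr1 eqSS val_eqE.
  have [->|ik] := eqVneq i k; first by rewrite mulr1 sqr.
  by rewrite !mulr0.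
case: eqVneq => [->|_]; last by rewrite subr0.
rewrite !mulr1n -rmorphB /=; congr (_%:C).
have kn : (k <= n)%N by rewrite -ltnS.
have := qnum_mulB (n - k)%:R k%:R q0 q1.
rewrite !natr1 mulrC => ->; congr (qnum q _).
by rewrite natrB // /weight /spin; field.
Qed.

Lemma qJ0_Jplus q a n : 0 < q ->
  qJ0 q a n *m Jplus q n = (q `^ a)%:C *: (Jplus q n *m qJ0 q a n).
Proof.
move=> q0; rewrite mul_diag_mx mul_mx_diag; apply/matrixP => i k.
rewrite [LHS]mxE [RHS]mxE [in RHS]mxE JplusE !mxE.
have [ik|_] := eqVneq (i : nat) k.+1; last by rewrite !(mulr0, mul0r).
have -> : weight R i = weight R k + 1 by rewrite /weight ik -natr1; ring.
by rewrite mulrDr mulr1 powRD_gt0 // rmorphM /=; ring.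
Qed.

Lemma qJ0_Jminus q a n : 0 < q ->
  qJ0 q a n *m Jminus q n = (q `^ (- a))%:C *: (Jminus q n *m qJ0 q a n).
Proof.
move=> q0; apply: trmx_inj; rewrite linearZ /= !trmx_mul -trmx_Jplus trmxK.
rewrite tr_diag_mx qJ0_Jplus // scalerA -rmorphM /= -powRD_gt0 //.
by rewrite addNr powRr0 scale1r.
Qed.

(** * Kronecker products and their action on coordinates *)

Lemma tensmxDl m n p r (A B : 'M[R[i]]_(m, n)) (C : 'M_(p, r)) :
  (A + B) *t C = A *t C + B *t C.
Proof. by apply/matrixP => i k; rewrite !mxE mulrDl. Qed.

Lemma tensmxDr m n p r (A B : 'M[R[i]]_(m, n)) (C : 'M_(p, r)) :
  C *t (A + B) = C *t A + C *t B.
Proof. by apply/matrixP => i k; rewrite !mxE mulrDr. Qed.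

Lemma tensmxZl m n p r c (A : 'M[R[i]]_(m, n)) (C : 'M_(p, r)) :
  (c *: A) *t C = c *: (A *t C).
Proof. by apply/matrixP => i k; rewrite !mxE mulrA. Qed.

Lemma tensmxZr m n p r c (A : 'M[R[i]]_(m, n)) (C : 'M_(p, r)) :
  C *t (c *: A) = c *: (C *t A).
Proof. by apply/matrixP => i k; rewrite !mxE mulrCA. Qed.

(** [Jplus12] and [Jminus12] have this shape. The scalars [c] and [c'] are placed so that the mixed
    terms agree in both orders, which leaves only the commutators within each factor. *)
Lemma tensmx_comm m p (A1 B1 L D1 : 'M[R[i]]_m) (A2 B2 K D2 : 'M[R[i]]_p) c c' :
  A1 *m B1 = B1 *m A1 + D1 -> A2 *m B2 = B2 *m A2 + D2 ->
  L *m A1 = c' *: (A1 *m L) -> L *m B1 = c *: (B1 *m L) ->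
  K *m A2 = c *: (A2 *m K) -> K *m B2 = c' *: (B2 *m K) ->
  (A1 *t K + L *t A2) *m (B1 *t K + L *t B2) =
  (B1 *t K + L *t B2) *m (A1 *t K + L *t A2)
    + (D1 *t (K *m K) + (L *m L) *t D2).
Proof.
move=> h1 h2 LA LB KA KB; rewrite !mulmxDl !mulmxDr !tensmx_mul.
rewrite h1 h2 LA LB KA KB tensmxDl tensmxDr !tensmxZl !tensmxZr.
by rewrite [LHS]addrACA [RHS]addrACA; congr (_ + _); rewrite (addrAC, addrA).
Qed.

Lemma sum_mxtens_index m n (f : 'I_(m * n) -> R[i]) :
  \sum_k f k = \sum_k1 \sum_k2 f (mxtens_index (k1, k2)).
Proof.
rewrite pair_big; apply: reindex => /=; exists (@mxtens_unindex m n).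
  by case=> k1 k2 _ /=; rewrite mxtens_indexK.
by move=> k _; case: (mxtens_indexP k) => k1 k2; rewrite mxtens_indexK.
Qed.

Lemma tensmx_mulE m n p r (A : 'M[R[i]]_(m, n)) (B : 'M_(p, r))
    (v : 'cV_(n * r)) i1 i2 :
  ((A *t B) *m v) (mxtens_index (i1, i2)) 0 =
  \sum_k1 \sum_k2 A i1 k1 * B i2 k2 * v (mxtens_index (k1, k2)) 0.
Proof.
rewrite mxE sum_mxtens_index; apply: eq_bigr => k1 _; apply: eq_bigr => k2 _.
by rewrite tensmxE.
Qed.

Lemma tensmx_mul_single m n p r (A : 'M[R[i]]_(m, n)) (B : 'M_(p, r))
    (v : 'cV_(n * r)) i1 i2 k1 k2 :
  (forall j, j != k1 -> A i1 j = 0) -> (forall j, j != k2 -> B i2 j = 0) ->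
  ((A *t B) *m v) (mxtens_index (i1, i2)) 0 =
  A i1 k1 * B i2 k2 * v (mxtens_index (k1, k2)) 0.
Proof.
move=> A0 B0; rewrite tensmx_mulE (bigD1 k1) //= (bigD1 k2) //= !big1 ?addr0 //.
  by move=> j1 j1k; apply: big1 => j2 _; rewrite A0 // !mul0r.
by move=> j2 j2k; rewrite B0 // mulr0 mul0r.
Qed.

Lemma tens_diagE m n d1 d2 (v : 'cV[R[i]]_(m * n)) i1 i2 :
  ((diag_mx d1 *t diag_mx d2) *m v) (mxtens_index (i1, i2)) 0 =
  d1 0 i1 * d2 0 i2 * v (mxtens_index (i1, i2)) 0.
Proof.
have diag0 l (d : 'rV[R[i]]_l) i j : j != i -> diag_mx d i j = 0.
  by move=> ji; rewrite mxE eq_sym (negPf ji) mulr0n.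
rewrite (tensmx_mul_single _ (diag0 _ d1 i1) (diag0 _ d2 i2)).
by rewrite !mxE !eqxx !mulr1n.
Qed.

(** * Weights and generators on the tensor product *)

Variables (q : R) (n1 n2 : nat).
Hypotheses (q_gt0 : 0 < q) (q_lt1 : q < 1).
Local Notation E := (Jplus12 q n1 n2).
Local Notation F := (Jminus12 q n1 n2).
Local Notation idx i1 i2 := (mxtens_index (i1, i2)).

Lemma trmx_Jplus12 : E^T = F.
Proof. by rewrite linearD /= !trmx_tens !trmx_Jplus !tr_diag_mx. Qed.

(* The eigenspace of [J_0(12)] for the eigenvalue [mu]. *)
Definition has_weight12 (mu : R) (v : 'cV[R[i]]_(n1.+1 * n2.+1)) : Prop :=
  forall i1 i2, weight R i1 + weight R i2 != mu -> v (idx i1 i2) 0 = 0.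

Lemma raise12 mu v : has_weight12 mu v -> has_weight12 (mu + 1) (E *m v).
Proof.
move=> wv i1 i2 wi; rewrite mulmxDl mxE !tensmx_mulE !big1 ?addr0 // => k1 _.
- apply: big1 => k2 _; rewrite qJ0E JplusE.
  have [<-|_] := eqVneq i1 k1; last by rewrite !(mulr0, mul0r).
  have [ik|_] := eqVneq (i2 : nat) k2.+1; last by rewrite !(mulr0, mul0r).
  rewrite wv ?mulr0 //; apply: contra wi => /eqP <-.
  by rewrite /weight ik -natr1; apply/eqP; ring.
apply: big1 => k2 _; rewrite qJ0E JplusE.
have [<-|_] := eqVneq i2 k2; last by rewrite !(mulr0, mul0r).
have [ik|_] := eqVneq (i1 : nat) k1.+1; last by rewrite !(mulr0, mul0r).
rewrite wv ?mulr0 //; apply: contra wi => /eqP <-.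
by rewrite /weight ik -natr1; apply/eqP; ring.
Qed.

Lemma lower12 mu v : has_weight12 mu v -> has_weight12 (mu - 1) (F *m v).
Proof.
move=> wv i1 i2 wi; rewrite mulmxDl mxE !tensmx_mulE !big1 ?addr0 // => k1 _.
- apply: big1 => k2 _; rewrite qJ0E -trmx_Jplus mxE JplusE.
  have [<-|_] := eqVneq i1 k1; last by rewrite !(mulr0, mul0r).
  have [ik|_] := eqVneq (k2 : nat) i2.+1; last by rewrite !(mulr0, mul0r).
  rewrite wv ?mulr0 //; apply: contra wi => /eqP <-.
  by rewrite /weight ik -natr1; apply/eqP; ring.
apply: big1 => k2 _; rewrite qJ0E -trmx_Jplus mxE JplusE.
have [<-|_] := eqVneq i2 k2; last by rewrite !(mulr0, mul0r).
have [ik|_] := eqVneq (k1 : nat) i1.+1; last by rewrite !(mulr0, mul0r).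
rewrite wv ?mulr0 //; apply: contra wi => /eqP <-.
by rewrite /weight ik -natr1; apply/eqP; ring.
Qed.

(** [tensmx_comm] leaves a diagonal operator, whose entry at weights [w1], [w2] is [[2 w1] q^(2 w2)
    + q^(-2 w1) [2 w2]]; [qnum_coproduct] evaluates it. *)
Lemma Jplus12_Jminus12 mu v : has_weight12 mu v ->
  E *m (F *m v) = F *m (E *m v) + (qnum q (2 * mu))%:C *: v.
Proof.
move=> wv.
pose D n := diag_mx (\row_k (qnum q (2 * weight R k))%:C) : 'M[R[i]]_n.+1.
have EF : E *m F = F *m E + (D n1 *t (qJ0 q 1 n2 *m qJ0 q 1 n2)
                        + (qJ0 q (-1) n1 *m qJ0 q (-1) n1) *t D n2).
  have comm n : Jplus q n *m Jminus q n = Jminus q n *m Jplus q n + D n.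
    by rewrite /D -Jplus_Jminus // addrC subrK.
  apply: (tensmx_comm (comm n1) (comm n2)).
  - exact: qJ0_Jplus.
  - exact: qJ0_Jminus.
  (* The preceding goal has fixed [c] as [q] to the power [- -1]. *)
  - by rewrite opprK; apply: qJ0_Jplus.
  - exact: qJ0_Jminus.
rewrite !mulmxA EF mulmxDl; congr (_ + _).
apply/colP => i; case: (mxtens_indexP i) => i1 i2.
rewrite !mulmx_diag mulmxDl mxE !tens_diagE [RHS]mxE !mxE -mulrDl.
have [wi|wi] := eqVneq (weight R i1 + weight R i2) mu; last by rewrite wv ?mulr0.
rewrite -!rmorphM -rmorphD /= -!powRD_gt0 // -wi; congr (_ * _).
move: (weight R i1) (weight R i2) => w1 w2.
by rewrite mulrDr -(qnum_coproduct (2 * w1)) //;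
  congr ((_ * q `^ _ + q `^ _ * _)%:C); ring.
Qed.

Lemma has_weight12_big mu v : (n1 + n2)%:R / 2 < mu -> has_weight12 mu v -> v = 0.
Proof.
move=> mu_big wv; apply/colP => i; case: (mxtens_indexP i) => i1 i2.
rewrite mxE wv // lt_eqF // (le_lt_trans _ mu_big) //.
have le1 : i1%:R <= n1%:R :> R by rewrite ler_nat -ltnS.
have le2 : i2%:R <= n2%:R :> R by rewrite ler_nat -ltnS.
by rewrite /weight /spin natrD; lra.
Qed.

Lemma extremal12_highest n v : has_weight12 (n%:R / 2) v ->
  E *m (extremal q E F n (n1 + n2) *m v) = 0.
Proof.
move=> wv; apply: (extremal_highest q_gt0 q_lt1 raise12 lower12 Jplus12_Jminus12 wv).
(* [E^(n1+n2+1) v] has weight [n/2 + n1 + n2 + 1], beyond the largest weight [j1 + j2], so the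
   truncation at [n1 + n2] loses nothing. *)
apply: has_weight12_big (raiseX raise12 _ wv).
have n_ge0 : 0 <= n%:R :> R by [].
have N_ge0 : 0 <= (n1 + n2)%:R :> R by [].
rewrite -[(n1 + n2).+1%:R]natr1.
move: (n%:R : R) ((n1 + n2)%:R : R) n_ge0 N_ge0 => a b a0 b0; lra.
Qed.

Lemma has_weight12D mu u v :
  has_weight12 mu u -> has_weight12 mu v -> has_weight12 mu (u + v).
Proof. by move=> wu wv i1 i2 wi; rewrite mxE wu ?wv ?addr0. Qed.

Lemma has_weight12Z mu c v : has_weight12 mu v -> has_weight12 mu (c *: v).
Proof. by move=> wv i1 i2 wi; rewrite mxE wv ?mulr0. Qed.

Lemma has_weight12_extremal mu n b v :
  has_weight12 mu v -> has_weight12 mu (extremal q E F n b *m v).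
Proof.
move=> wv; rewrite /extremal mulmx_suml.
elim/big_ind: _ => [|u w|r _]; first by move=> i1 i2 _; rewrite mxE.
  exact: has_weight12D.
rewrite -scalemxAl -mulmxA; apply: has_weight12Z.
by have := lowerX lower12 r (raiseX raise12 r wv); rewrite addrK.
Qed.

Lemma has_weight12_delta i1 i2 :
  has_weight12 (weight R i1 + weight R i2) (delta_mx (idx i1 i2) 0).
Proof.
move=> k1 k2 wk; rewrite mxE eqxx andbT.
case: eqP => // /(can_inj (@mxtens_indexK _ _)) [e1 e2].
by rewrite e1 e2 eqxx in wk.
Qed.

(** * Vectors killed by [E] and their alternating coordinates *)

Local Notation at_ k1 k2 := (idx (inord k1 : 'I_n1.+1) (inord k2 : 'I_n2.+1)).

(** Coordinate [(k1+1, k2+1)] of [E v] receives only [v] at [(k1, k2+1)] and at [(k1+1, k2)], both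
    with positive coefficients; its vanishing forces opposite signs. *)
Lemma highest_weight_step k1 k2 : (k1 < n1)%N -> (k2 < n2)%N ->
  exists2 r : R, 0 < r & forall v : 'cV_(n1.+1 * n2.+1), E *m v = 0 ->
    v (at_ k1 k2.+1) 0 = - (r%:C * v (at_ k1.+1 k2) 0).
Proof.
move=> lt1 lt2.
have J0 n k : (k < n)%N -> 0 < Num.sqrt (qnum q (n - k)%:R * qnum q k.+1%:R).
  by move=> ltkn; rewrite sqrtr_gt0 mulr_gt0 ?qnum_gt0 ?ltr0n ?subn_gt0.
(* [a] and [b] are these two coefficients, coming from the first and the second summand of [E]. *)
pose a := Num.sqrt (qnum q (n1 - k1)%:R * qnum q k1.+1%:R)
  * q `^ (1 * weight R (inord k2.+1 : 'I_n2.+1)).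
pose b := q `^ (-1 * weight R (inord k1.+1 : 'I_n1.+1))
  * Num.sqrt (qnum q (n2 - k2)%:R * qnum q k2.+1%:R).
have a0 : 0 < a by rewrite mulr_gt0 ?J0 ?powR_gt0.
have b0 : 0 < b by rewrite mulr_gt0 ?J0 ?powR_gt0.
exists (b / a) => [|v /(congr1 (fun u : 'cV_(_ * _) => u (at_ k1.+1 k2.+1) 0))].
  by rewrite divr_gt0.
(* [inord] falls back to [0] out of range, so the bounds on [k] matter here. *)
have inE n k : (k < n)%N -> (inord k : 'I_n.+1) = k :> nat.
  by move=> ltkn; rewrite inordK // ltnS ltnW.
have inSE n k : (k < n)%N -> (inord k.+1 : 'I_n.+1) = k.+1 :> nat.
  by move=> ltkn; rewrite inordK.
have Jplus0 n k (j : 'I_n.+1) : (k < n)%N -> j != inord k ->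
    Jplus q n (inord k.+1) j = 0.
  move=> ltkn jk; rewrite JplusE inSE // eqSS.
  suff /negPf -> : k != j by rewrite mulr0.
  by apply: contra jk => /eqP ->; rewrite inord_val.
have qJ00 a' n (k j : 'I_n.+1) : j != k -> qJ0 q a' n k j = 0.
  by move=> jk; rewrite qJ0E eq_sym (negPf jk) mulr0.
rewrite [RHS]mxE mulmxDl mxE.
rewrite (tensmx_mul_single _ (fun j => Jplus0 n1 k1 j lt1) (qJ00 _ n2 _)).
rewrite (tensmx_mul_single _ (qJ00 _ n1 _) (fun j => Jplus0 n2 k2 j lt2)).
rewrite !JplusE !qJ0E !inSE // !inE // !eqxx !mulr1 -!rmorphM /= -/a -/b.
move=> /eqP; rewrite addr_eq0 => /eqP e.
have aC : a%:C != 0 :> R[i] by rewrite (inj_eq (@complexI _)) ?gt_eqF.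
by apply: (mulfI aC); rewrite e mulrN mulrA -rmorphM /= mulrCA divff ?gt_eqF // mulr1.
Qed.

(** For [d = j1 + j2 - j] the chain starts at [|j1 j1>|j2 j-j1>]; each step lowers [m1], raises [m2]
    and costs one sign. *)
Lemma highest_weight_chain d t : (d <= n1)%N -> (d <= n2)%N -> (t <= d)%N ->
  exists2 r : R, 0 < r & forall v : 'cV_(n1.+1 * n2.+1), E *m v = 0 ->
    v (at_ (n1 - t) (n2 - d + t)) 0
      = (-1) ^+ t * r%:C * v (at_ n1 (n2 - d)) 0.
Proof.
move=> dn1 dn2; elim: t => [|t IHt] td.
  by exists 1 => // v _; rewrite subn0 addn0 expr0 !mul1r.
have [r r0 IH] := IHt (ltnW td).
have lt1 : (n1 - t.+1 < n1)%N by lia.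
have lt2 : (n2 - d + t < n2)%N by lia.
have [s s0 step] := highest_weight_step lt1 lt2.
exists (s * r) => [|v Ev0]; first exact: mulr_gt0.
rewrite addnS step // subnSK ?IH //; last by lia.
by rewrite exprS rmorphM /=; ring.
Qed.

(** Every basis vector of weight [j] lies on the chain: the one with indices [i1], [i2] is reached
    at [t = n1 - i1]. *)
Lemma highest_weight_eq0 d n (v : 'cV_(n1.+1 * n2.+1)) : (d <= n1)%N -> (d <= n2)%N ->
  (n + d.*2 = n1 + n2)%N -> has_weight12 (n%:R / 2) v -> E *m v = 0 ->
  v (at_ n1 (n2 - d)) 0 = 0 -> v = 0.
Proof.
move=> dn1 dn2 nd wv Ev0 v0; apply/colP => i.
case: (mxtens_indexP i) => i1 i2; rewrite [RHS]mxE.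
have [wi|] := eqVneq (weight R i1 + weight R i2) (n%:R / 2); last exact: wv.
have lt1 := ltn_ord i1; have lt2 := ltn_ord i2.
have ii : (i1 + i2 + d = n1 + n2)%N.
  apply/eqP; rewrite -(eqr_nat R) !natrD; apply/eqP.
  have := congr1 (fun k : nat => k%:R : R) nd.
  rewrite -muln2 !natrD natrM => nd'; move: wi; rewrite /weight /spin => wi.
  lra.
have td : (n1 - i1 <= d)%N by lia.
have [r _ /(_ v Ev0)] := highest_weight_chain dn1 dn2 td.
rewrite v0 mulr0 (_ : n1 - (n1 - i1) = i1)%N; last by lia.
by rewrite (_ : n2 - d + (n1 - i1) = i2)%N ?inord_val //; lia.
Qed.

(** Both sides have weight [j] and are killed by [E], so comparing their coordinates at [x] is
    enough. *)
Lemma extremal12_delta d n : (d <= n1)%N -> (d <= n2)%N ->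
  (n + d.*2 = n1 + n2)%N ->
  let S := extremal q E F n (n1 + n2) in
  exists2 r : R, 0 < r &
    S *m delta_mx (at_ (n1 - d) n2) 0 =
      ((-1) ^+ d * r%:C) *: (S *m delta_mx (at_ n1 (n2 - d)) 0) :> 'cV_(_ * _).
Proof.
move=> dn1 dn2 nd S.
have [r r0 chain] := highest_weight_chain dn1 dn2 (leqnn d).
rewrite subnK // in chain.
set x := at_ n1 _ in chain *; set y := at_ _ n2 in chain *.
exists r => //; apply/eqP; rewrite -subr_eq0; apply/eqP.
have nd' : n%:R + d%:R * 2 = n1%:R + n2%:R :> R.
  by rewrite -natrM muln2 -!natrD nd.
have wx : has_weight12 (n%:R / 2) (delta_mx x 0).
  rewrite (_ : n%:R / 2 = weight R (inord n1 : 'I_n1.+1)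
                         + weight R (inord (n2 - d) : 'I_n2.+1)).
    exact: has_weight12_delta.
  rewrite /weight /spin !inordK ?ltnS ?leq_subr // natrB //; lra.
have wy : has_weight12 (n%:R / 2) (delta_mx y 0).
  rewrite (_ : n%:R / 2 = weight R (inord (n1 - d) : 'I_n1.+1)
                         + weight R (inord n2 : 'I_n2.+1)).
    exact: has_weight12_delta.
  rewrite /weight /spin !inordK ?ltnS ?leq_subr // natrB //; lra.
have Sx0 := extremal12_highest wx; have Sy0 := extremal12_highest wy.
apply: (highest_weight_eq0 dn1 dn2 nd).
- rewrite -scaleNr; apply: has_weight12D; first exact: has_weight12_extremal.
  exact/has_weight12Z/has_weight12_extremal.
- by rewrite mulmxBr -scalemxAr Sx0 Sy0 scaler0 subr0.
rewrite -/x [LHS]mxE [X in _ + X]mxE [X in _ - X]mxE.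
(* Symmetry of [S] trades coordinate [x] of [S y] for coordinate [y] of [S x], which the full chain
   [t = d] relates to coordinate [x] of [S x]. *)
have -> : (S *m delta_mx y 0 : 'cV_(_ * _)) x 0
    = (S *m delta_mx x 0 : 'cV_(_ * _)) y 0.
  have trS : S^T = S := trmx_extremal q n (n1 + n2) trmx_Jplus12.
  by rewrite -!colE -[in RHS]trS !mxE.
by rewrite -chain ?subrr.
Qed.

Lemma projP_extremal n (m : 'I_n.+1) :
  projP q n1 n2 m =
  (Num.sqrt (qfact q m / (qfact q n * qfact q (n - m))))%:C *:
  (F ^+ (n - m) *m extremal q E F n (n1 + n2)).
Proof.
rewrite /projP mulmx_sumr; congr (_ *: _); apply: eq_bigr => r _.
by rewrite -scalemxAr mulmxA mulmxE -exprD (addnC r).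
Qed.

End TensorProduct.

(** * Exchange of the tensor factors and inversion of the base *)

Section Flip.
Variables (R : realType) (n1 n2 : nat).

(** The permutation matrix exchanging the factors. It is typed as rectangular because the two orders
    of the product give dimensions that are not convertible. *)
Definition flip : 'M[R[i]]_(n2.+1 * n1.+1, n1.+1 * n2.+1) :=
  \matrix_(i, k) (mxtens_unindex i == swap_pair (mxtens_unindex k))%:R.

Lemma flipE (v : 'cV_(n1.+1 * n2.+1)) i1 i2 :
  (flip *m v) (mxtens_index (i2, i1)) 0 = v (mxtens_index (i1, i2)) 0.
Proof.
rewrite mxE (bigD1 (mxtens_index (i1, i2))) //= big1 ?addr0.
  by rewrite mxE !mxtens_indexK eqxx mul1r.
move=> k; case: (mxtens_indexP k) => k1 k2 ki; rewrite mxE !mxtens_indexK.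
rewrite xpair_eqE /=; case: eqP => [e2|]; last by rewrite mul0r.
by case: eqP => [e1|]; [rewrite -e1 -e2 eqxx in ki | rewrite mul0r].
Qed.

Lemma flip_tens (A : 'M_n1.+1) (B : 'M_n2.+1) (v : 'cV_(n1.+1 * n2.+1)) :
  flip *m ((A *t B) *m v) = (B *t A) *m (flip *m v).
Proof.
apply/colP => i; case: (mxtens_indexP i) => i2 i1.
rewrite flipE !tensmx_mulE exchange_big; apply: eq_bigr => k2 _.
by apply: eq_bigr => k1 _; rewrite flipE [A _ _ * _]mulrC.
Qed.

Lemma flip_delta i1 i2 : flip *m delta_mx (mxtens_index (i1, i2)) 0 =
  delta_mx (mxtens_index (i2, i1)) 0 :> 'cV_(_ * _).
Proof.
apply/colP => i; case: (mxtens_indexP i) => k2 k1; rewrite flipE !mxE.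
rewrite !(can_eq (@mxtens_indexK _ _)) !xpair_eqE.
by rewrite [(k1 == i1) && _]andbC.
Qed.

Lemma vnorm_flip (v : 'cV_(n1.+1 * n2.+1)) : vnorm (flip *m v) = vnorm v.
Proof.
rewrite /vnorm !sum_mxtens_index exchange_big; congr sqrtC.
by apply: eq_bigr => i1 _; apply: eq_bigr => i2 _; rewrite flipE.
Qed.

Variable q : R.
Hypothesis q_gt0 : 0 < q.

(** The exchange turns [J_+ (x) q^(J_0)] into [q^(J_0) (x) J_+], the second summand for base [1/q];
    the other summand behaves alike, and [Jplus] itself is unchanged by [JplusV]. *)
Lemma flip_Jplus12 (v : 'cV_(n1.+1 * n2.+1)) :
  flip *m (Jplus12 q n1 n2 *m v) = Jplus12 q^-1 n2 n1 *m (flip *m v).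
Proof.
rewrite /Jplus12 mulmxDl mulmxDr !flip_tens -mulmxDl addrC.
have e1 := JplusV n1 q_gt0; have e2 := JplusV n2 q_gt0.
have e3 := qJ0V 1 n1 q_gt0; have e4 := qJ0V (-1) n2 q_gt0.
rewrite opprK in e4; move: q^-1 e1 e2 e3 e4 => p.
by move=> -> -> -> ->.
Qed.

Lemma flip_Jminus12 (v : 'cV_(n1.+1 * n2.+1)) :
  flip *m (Jminus12 q n1 n2 *m v) = Jminus12 q^-1 n2 n1 *m (flip *m v).
Proof.
rewrite /Jminus12 mulmxDl mulmxDr !flip_tens -mulmxDl addrC.
have e1 := JminusV n1 q_gt0; have e2 := JminusV n2 q_gt0.
have e3 := qJ0V 1 n1 q_gt0; have e4 := qJ0V (-1) n2 q_gt0.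
rewrite opprK in e4; move: q^-1 e1 e2 e3 e4 => p.
by move=> -> -> -> ->.
Qed.

Lemma flipX (A : 'M_(n1.+1 * n2.+1)) (B : 'M_(n2.+1 * n1.+1)) r :
  (forall v : 'cV_(_ * _), flip *m (A *m v) = B *m (flip *m v)) ->
  forall v : 'cV_(_ * _), flip *m (A ^+ r *m v) = B ^+ r *m (flip *m v).
Proof.
move=> AB; elim: r => [|r IHr] v; first by rewrite !expr0 !mul1mx.
by rewrite !exprS -!mulmxE -!mulmxA AB IHr.
Qed.

(** The coefficients are built from q-factorials, invariant under inversion of the base, so only the
    operators have to be transported. *)
Lemma flip_projP n (m : 'I_n.+1) (v : 'cV_(n1.+1 * n2.+1)) :
  flip *m (projP q n1 n2 m *m v) = projP q^-1 n2 n1 m *m (flip *m v).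
Proof.
rewrite /projP (addnC n2 n1) !qfactV // -!scalemxAl -scalemxAr; congr (_ *: _).
rewrite !mulmx_suml mulmx_sumr; apply: eq_bigr => r _.
rewrite !qfactV // -!scalemxAl -scalemxAr; congr (_ *: _).
by rewrite -!mulmxA (flipX _ flip_Jminus12) (flipX _ flip_Jplus12).
Qed.

End Flip.

(** * Reduction to basis vectors, normalization and conclusion *)

Lemma tens_ket (R : realType) n1 n2 (i1 : 'I_n1.+1) (i2 : 'I_n2.+1) :
  ket n1 (weight R i1) *t ket n2 (weight R i2) =
  delta_mx (mxtens_index (i1, i2)) 0 :> 'cV[R[i]]_(n1.+1 * n2.+1).
Proof.
apply/colP => i; case: (mxtens_indexP i) => k1 k2.
rewrite !mxE !mxtens_indexK /= !(inj_eq (@weight_inj R _)) eqxx andbT.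
by rewrite (can_eq (@mxtens_indexK _ _)) xpair_eqE -natrM mulnb.
Qed.

Lemma clebsch_gordanE (R : realType) (q : R) n1 n2 n (m1 : 'I_n1.+1)
    (m2 : 'I_n2.+1) (m : 'I_n.+1) (i1 : 'I_n1.+1) (i2 : 'I_n2.+1) :
  spin R n1 = weight R i1 -> spin R n - spin R n1 = weight R i2 ->
  let v := projP q n1 n2 m *m delta_mx (mxtens_index (i1, i2)) 0 : 'cV_(_ * _) in
  clebsch_gordan q m1 m2 m = (vnorm v)^-1 * v (mxtens_index (m1, m2)) 0.
Proof.
move=> h1 h2 v; rewrite /clebsch_gordan /coupled h2 h1 tens_ket.
exact: mxE.
Qed.

Lemma vnormZ (R : realType) N c (v : 'cV[R[i]]_N) :
  vnorm (c *: v) = `|c| * vnorm v.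
Proof.
rewrite /vnorm.
under eq_bigr => k _ do rewrite mxE normrM exprMn.
rewrite -mulr_sumr sqrtCM ?nnegrE ?exprn_ge0 ?sumr_ge0 //; last first.
  by move=> k _; rewrite exprn_ge0.
by rewrite exprCK.
Qed.

(* j1 = n1 / 2, j2 = n2 / 2 and j = n / 2. *)
Theorem mainTheorem2 (R : realType) (q : R) (n1 n2 n : nat)
    (m1 : 'I_n1.+1) (m2 : 'I_n2.+1) (m : 'I_n.+1)
    (hq0 : 0 < q) (hq1 : q < 1)
    (hj : (`|n1 - n2| <= n <= n1 + n2)%N)
    (hpar : ~~ odd (n1 + n2 - n))
    (hm : weight R m = weight R m1 + weight R m2) :
  clebsch_gordan q m1 m2 m =
  (-1) ^+ (n1 + n2 - n)./2 * clebsch_gordan q^-1 m2 m1 m.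
Proof.
set d := (n1 + n2 - n)./2.
(* The parity hypothesis makes the halving exact; the triangle inequalities then bound
   [d = j1 + j2 - j] by [n1] and [n2]. *)
have nd : (n + d.*2 = n1 + n2)%N by rewrite /d; lia.
have dn1 : (d <= n1)%N by lia.
have dn2 : (d <= n2)%N by lia.
have ndR : n%:R + d%:R * 2 = n1%:R + n2%:R :> R.
  by rewrite -natrM muln2 -!natrD nd.
have top l : spin R l = weight R (inord l : 'I_l.+1).
  by rewrite /weight /spin inordK //; field.
(* Stated for generic spins, to serve the starting vectors of both orders of the factors. *)
have low l l' : (d <= l)%N -> n%:R + d%:R * 2 = l'%:R + l%:R :> R ->
    spin R n - spin R l' = weight R (inord (l - d) : 'I_l.+1).
  move=> dl e; rewrite /weight /spin inordK ?ltnS ?leq_subr // natrB //; lra.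
rewrite (clebsch_gordanE _ _ _ _ (top n1) (low _ _ dn2 ndR)).
rewrite addrC in ndR; rewrite addrC [RHS]addrC in ndR.
rewrite (clebsch_gordanE _ _ _ _ (top n2) (low _ _ dn1 ndR)).
(* The starting vector for [1/q] is the exchanged [|j1 j-j2>|j2 j2>], so both coefficients can be
   read in [D^j1 (x) D^j2] with base [q]. *)
rewrite -(flip_delta R (inord (n1 - d) : 'I_n1.+1) (inord n2 : 'I_n2.+1)).
rewrite -(flip_projP hq0 m) vnorm_flip flipE.
have [r r0 swapS] := extremal12_delta hq0 hq1 dn1 dn2 nd.
rewrite !projP_extremal -!scalemxAl -!mulmxA swapS -!scalemxAr.
rewrite [_ *: (_ *: _)]scalerA [_ * ((-1) ^+ d * _)]mulrC -scalerA.
(* Up to the scalar [(-1)^d r], both sides now involve the same vector [u]. The norm absorbs [r > 0]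
   and leaves the sign. *)
move: (_ *: (_ *m _)) => u; rewrite vnormZ mxE.
have rC0 : r%:C != 0 :> R[i] by rewrite (inj_eq (@complexI _)) gt_eqF.
have -> : `|(-1) ^+ d * r%:C| = r%:C :> R[i].
  by rewrite normrM normrX normrN1 expr1n mul1r ger0_norm // lecR ltW.
have s2 : (-1) ^+ d * (-1) ^+ d = 1 :> R[i] by rewrite -expr2 sqrr_sign.
rewrite invfM; move: (r%:C) ((-1) ^+ d) rC0 s2 => rho s rho0 s2.
(* The relations [s * s = 1] and [rho^-1 * rho = 1] are inserted as factors, which leaves a plain
   ring identity. *)
rewrite -[LHS]mul1r -s2 -[LHS]mul1r -(mulVf rho0); ring.
Qed.
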